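(* Let $P$ be a finite graded poset of rank $r$. Let $\Delta$ be the simplicial complex whose Stanley-Reisner ideal is the flag ideal $\mathcal{F}(P)\subseteq\Bbbk[x_P]$ and let $A\subseteq P$ be a multidegree. The restriction $\Delta_A$ is homotopy equivalent to the join $X_1(A)\ast\cdots\ast X_{r-1}(A)$.
   Context: Let $\Bbbk$ be a field. A finite poset $P$ is graded if it has a rank function $r_P:P\to\mathbb{N}$ with $r_P(p)=1$ for every minimal element $p$ and $r_P(q)=r_P(p)+1$ whenever $q$ covers $p$; the rank of $P$ is $\max\{r_P(p): p\in P\}$. $\max(P)$ is the set of maximal elements of $P$, and $P_i$ is the set of elements of rank $i$. $\Bbbk[x_P]=\Bbbk[x_p: p\in P]$. The flag ideal $\mathcal{F}(P)$ is generated by all monomials $x_{p_1}\cdots x_{p_n}$ with $p_1<\cdots<p_n$ a maximal chain of $P$. The restriction $\Delta_A$ is the complex of faces of $\Delta$ contained in $A$. Simplicial complexes on a vertex set $V$ may have elements of $V$ that are not faces; the Stanley-Reisner ideal is generated by the squarefree monomials of non-faces. For $A\subseteq P$ put $A_i=A\cap P_i$, $B_i=A_i\setminus\max(P)$ for $i=2,\ldots,r-1$, $B_1=A_1$ and $B_r=A_r$. Let $G$ be the graph on vertex set $A$ whose edges are the pairs $\{a_i,a_{i+1}\}$ with $a_i\in B_i$, $a_{i+1}\in A_{i+1}$, $1\le i\le r-1$, such that $a_{i+1}$ covers $a_i$ in $P$. For $1\le i\le r-1$, $X_i(A)$ is the simplicial complex on $B_i\cup A_{i+1}$ whose Stanley-Reisner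 ideal is the edge ideal of the induced bipartite subgraph of $G$ on $B_i\cup A_{i+1}$.
   Formalization: Added assumption: if r > 1, A contains no element of P that is both minimal and maximal. Without it the claim fails: for P = {p} ∪ {a<b} and A = P, the restriction is two points while X_1(A) is a contractible path. *)

(* Defs.v *)
From HB Require Import structures.
From mathcomp Require Import all_boot all_order all_algebra.
From mathcomp Require Export monalg.
From mathcomp Require Import all_classical all_reals topology normedtype.
Import numFieldNormedType.Exports.
Import Order.TTheory GRing.Theory Num.Theory.

Set Implicit Arguments.
Unset Strict Implicit.
Unset Printing Implicit Defensive.

Local Open Scope classical_set_scope.
Local Open Scope ring_scope.

(** * Finite graded posets *)

Section Poset.
Variables (d : Order.disp_t) (P : finPOrderType d).

Definition covers (p q : P) : bool :=
  (p < q)%O && ~~ [exists z : P, (p < z)%O && (z < q)%O].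

Definition is_minimal (p : P) : bool := ~~ [exists z : P, (z < p)%O].

Definition max_elts : {set P} := [set p | ~~ [exists z : P, (p < z)%O]]%SET.

Definition is_rank_function (rk : P -> nat) : Prop :=
  (forall p, is_minimal p -> rk p = 1%N) /\
  (forall p q, covers p q -> rk q = (rk p).+1).

Definition poset_rank (rk : P -> nat) : nat := \max_(p : P) rk p.

Definition is_chain (C : {set P}) : bool :=
  [forall p in C, forall q in C, (p <= q)%O || (q <= p)%O].

Definition is_maximal_chain (C : {set P}) : bool := maxset is_chain C.

End Poset.

(** * Polynomial rings on a finite set of variables and their ideals *)

Notation polyring k V := {malg k[{cmonom V}]}.

Definition ideal_gen (T : comNzRingType) (S : set T) : set T :=
  [set f | exists (n : nat) (c g : 'I_n -> T),
     (forall i, S (g i)) /\ f = \sum_(i < n) c i * g i].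

Definition xvar (k : fieldType) (V : finType) (v : V) : polyring k V :=
  << ucm v >>.

Definition xmon (k : fieldType) (V : finType) (F : {set V}) : polyring k V :=
  \prod_(v in F) xvar k v.

Definition flag_ideal (k : fieldType) (d : Order.disp_t) (P : finPOrderType d) :
    set (polyring k P) :=
  ideal_gen [set f | exists C : {set P}, is_maximal_chain C /\ f = xmon k C].
Arguments flag_ideal k {d} P.

Definition edge_ideal (k : fieldType) (V : finType) (e : rel V) :
    set (polyring k V) :=
  ideal_gen [set f | exists u v : V, e u v /\ f = xvar k u * xvar k v].
Arguments edge_ideal k {V} e.

(** * Simplicial complexes *)

(* A complex on the vertex set V; elements of V need not be faces.  Both the
   void complex and the complex whose only face is the empty set are allowed. *)
Record scomplex (V : finType) := Scomplex {
  faces : {set {set V}};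
  faces_down : forall F G : {set V},
    F \in faces -> G \subset F -> G \in faces }.

Definition sr_ideal (k : fieldType) (V : finType) (D : scomplex V) :
    set (polyring k V) :=
  ideal_gen [set f | exists F : {set V}, F \notin faces D /\ f = xmon k F].
Arguments sr_ideal k {V} D.

Section Restriction.
Variables (V : finType) (D : scomplex V) (A : {set V}).

Definition restriction_faces : {set {set V}} :=
  [set F in faces D | F \subset A]%SET.

Lemma restriction_down (F G : {set V}) :
  F \in restriction_faces -> G \subset F -> G \in restriction_faces.
Proof.
rewrite !inE => /andP[DF FA] GF.
by rewrite (faces_down DF GF) (fintype.subset_trans GF FA).
Qed.

Definition restriction : scomplex V := Scomplex restriction_down.

End Restriction.

(* The join of a finite family of complexes, on the disjoint union of the
   vertex sets.  The empty join is the complex whose only face is empty. *)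
Section Join.
Variables (I : finType) (W : I -> finType) (X : forall i, scomplex (W i)).

Definition join_fiber (F : {set {i : I & W i}}) (i : I) : {set W i} :=
  [set v | Tagged (fun j => W j : Type) v \in F]%SET.

Definition join_faces : {set {set {i : I & W i}}} :=
  [set F : {set {i : I & W i}} |
    [forall i, join_fiber F i \in faces (X i)]]%SET.

Lemma join_down (F G : {set {i : I & W i}}) :
  F \in join_faces -> G \subset F -> G \in join_faces.
Proof.
rewrite !inE => /forallP FX /fintype.subsetP GF; apply/forallP => i.
apply: (faces_down (FX i)).
by apply/fintype.subsetP => v; rewrite !inE; exact: GF.
Qed.

Definition join_complex : scomplex {i : I & W i} := Scomplex join_down.

End Join.

(** * Geometric realization and homotopy equivalence *)

(* Barycentric coordinates, with the topology of R^V; as a type, a [set]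
   carries the subspace topology. *)
Definition realization (R : realType) (V : finType) (D : scomplex V) :
    set {ptws V -> R} :=
  [set t : {ptws V -> R} |
    [/\ forall v, 0 <= t v, \sum_(v : V) t v = 1
      & [set v | t v != 0]%SET \in faces D]].
Arguments realization R {V} D.

Definition homotopic (R : realType) (X Y : topologicalType) (f g : X -> Y) :
    Prop :=
  exists H : X * R -> Y,
    [/\ {within [set: X] `*` `[0, 1], continuous H},
        forall x, H (x, 0) = f x & forall x, H (x, 1) = g x].

Definition homotopy_equivalent (R : realType) (X Y : topologicalType) : Prop :=
  exists (f : X -> Y) (g : Y -> X),
    [/\ continuous f, continuous g,
        homotopic R (g \o f) idfun & homotopic R (f \o g) idfun].

Definition complex_homotopy_equivalent (R : realType) (V W : finType)
    (D : scomplex V) (E : scomplex W) : Prop :=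
  homotopy_equivalent R (realization R D) (realization R E).

(** * The layers of a subset of a graded poset, and its cover graph *)

Section Layers.
Variables (d : Order.disp_t) (P : finPOrderType d).
Variables (rk : P -> nat) (r : nat) (A : {set P}).

Definition Apart (i : nat) : {set P} := [set p in A | rk p == i]%SET.

(* Ranks run from 1 to r; maximal elements are removed only in the ranks
   2, ..., r-1. *)
Definition Bpart (i : nat) : {set P} :=
  if (2 <= i <= r.-1)%N then Apart i :\: max_elts P else Apart i.

Definition up_edge (p q : P) : bool :=
  [exists i : 'I_r,
    [&& (1 <= i)%N, p \in Bpart i, q \in Apart i.+1 & covers p q]].

Definition Gedge : rel P := fun p q => up_edge p q || up_edge q p.

(* The vertex set B_i :|: A_(i+1), and the subgraph of G induced on it. *)
Definition layer (i : nat) : finType :=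
  {p : P | p \in Bpart i :|: Apart i.+1}.

Definition Glayer (i : nat) : rel (layer i) :=
  fun u v => Gedge (val u) (val v).

End Layers.
Arguments Glayer {d P} rk r A i u v.

(* Main.v *)
(* Split every p in A of middle rank into a copy in the layer rk p (where it is
   a lower vertex) and a copy in the layer rk p - 1 (where it is an upper
   vertex).  The join of the X_i is the independence complex of the union of the
   layer graphs, and forgetting the copy is a simplicial map to Delta_A: walking
   up a maximal chain contained in the image of an independent set, each element
   would have to be used as a lower vertex, which the top of the chain cannot be.
   If S is a nonempty face of Delta_A, then the layer graph over S has an
   isolated vertex c(S), since otherwise a maximal chain of P could be built
   inside S; so the preimage of every simplex is a cone.
   Because c(S) is isolated over all of S, the points c(S_0), ..., c(S_m) of a
   flag S_0 < ... < S_m span a face.  This gives a simplicial map from the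
   barycentric subdivision of Delta_A to the join, which is a homotopy inverse
   of the projection. *)
Require Import Defs.
From HB Require Import structures.
From mathcomp Require Import all_boot all_order all_algebra.
From mathcomp Require Import finmap zify.
From mathcomp Require Import all_classical all_reals topology normedtype.
Import numFieldNormedType.Exports.
Import Order.TTheory GRing.Theory Num.Theory.

Set Implicit Arguments.
Unset Strict Implicit.
Unset Printing Implicit Defensive.

Local Open Scope classical_set_scope.
Local Open Scope ring_scope.

(** * Squarefree monomial ideals *)

Section SquarefreeEvaluation.
Variables (k : fieldType) (V : finType) (F : {set V}).

(** The value of [m] at the indicator vector of [F]; as [0 ^+ 0 = 1], only the variables dividing
    [m] count. *)
Definition ind_monom (m : {cmonom V}) : k :=
  \prod_(v : V) (v \in F)%:R ^+ m v.

Lemma ind_monom_mmorphism : mmorphism ind_monom.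
Proof.
split=> [m1 m2|]; rewrite /ind_monom.
  by rewrite -big_split; apply: eq_bigr => v _; rewrite cmM exprD.
by rewrite big1 // => v _; rewrite cm1.
Qed.

HB.instance Definition _ :=
  monalg.isMultiplicative.Build _ _ ind_monom ind_monom_mmorphism.

Definition ind_eval (f : polyring k V) : k := mmap idfun ind_monom f.

HB.instance Definition _ := GRing.RMorphism.copy ind_eval (mmap idfun ind_monom).

Lemma ind_eval_xvar (v : V) : ind_eval (xvar k v) = (v \in F)%:R.
Proof.
rewrite /ind_eval mmapU mul1r /ind_monom (bigD1 v) //= big1.
  by rewrite cmU eqxx mulr1.
by move=> u uv; rewrite cmU eq_sym (negbTE uv).
Qed.

Lemma ind_eval_xvarM (u v : V) :
  ind_eval (xvar k u * xvar k v) = ((u \in F) && (v \in F))%:R.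
Proof. by rewrite -mulnb natrM -!ind_eval_xvar; exact: rmorphM. Qed.

Lemma ind_eval_xmon (G : {set V}) : ind_eval (xmon k G) = (G \subset F)%:R.
Proof.
rewrite /xmon rmorph_prod /=.
under eq_bigr do rewrite ind_eval_xvar.
case: (boolP (G \subset F)) => [/fintype.subsetP GF|].
  by rewrite big1 // => v /GF ->.
case/subsetPn => v vG vF.
by rewrite (bigD1 v) //= (negbTE vF) mul0r.
Qed.

Lemma ind_eval_ideal (S : set (polyring k V)) (f : polyring k V) :
  (forall g, S g -> ind_eval g = 0) -> ideal_gen S f -> ind_eval f = 0.
Proof.
move=> S0 [n] [c] [g] [Sg ->]; rewrite rmorph_sum big1 // => i _.
by rewrite rmorphM /= (S0 _ (Sg i)) mulr0.
Qed.

End SquarefreeEvaluation.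

Lemma ideal_gen_sub (T : comNzRingType) (S : set T) (f : T) :
  S f -> ideal_gen S f.
Proof.
move=> Sf; exists 1%N, (fun=> 1), (fun=> f); split=> //.
by rewrite big_ord1 mul1r.
Qed.

(* Evaluating at the indicator vector of F kills a squarefree monomial iff its
   support is not contained in F. *)
Lemma faces_sr_ideal (k : fieldType) (V : finType) (D : scomplex V)
    (S : set (polyring k V)) (F : {set V}) :
  sr_ideal k D = ideal_gen S ->
  F \in faces D <-> (forall f, S f -> ind_eval F f = 0).
Proof.
move=> DS; split=> [FD f Sf|S0].
  have : sr_ideal k D f by rewrite DS; exact: ideal_gen_sub.
  apply: ind_eval_ideal => _ [G [GD ->]].
  rewrite ind_eval_xmon; case: (boolP (G \subset F)) GD => // GF /negP[].
  exact: faces_down FD GF.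
apply/negPn/negP => FD.
have /(ind_eval_ideal S0)/eqP : ideal_gen S (xmon k F).
  by rewrite -DS; apply: ideal_gen_sub; exists F.
by rewrite ind_eval_xmon fintype.subxx oner_eq0.
Qed.

Lemma faces_flag_ideal (k : fieldType) (d : Order.disp_t) (P : finPOrderType d)
    (D : scomplex P) (F : {set P}) :
  sr_ideal k D = flag_ideal k P ->
  (F \in faces D) = ~~ [exists C : {set P}, is_maximal_chain C && (C \subset F)].
Proof.
move=> /faces_sr_ideal DE; apply/idP/idP => [/DE F0|noC].
  apply/existsP => -[C /andP[maxC CF]].
  have /eqP := F0 (xmon k C) (ex_intro _ C (conj maxC erefl)).
  by rewrite ind_eval_xmon CF oner_eq0.
apply/DE => _ [C [maxC ->]]; rewrite ind_eval_xmon.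
by case: (boolP (C \subset F)) noC => // CF /existsP[]; exists C; rewrite maxC.
Qed.

Lemma faces_edge_ideal (k : fieldType) (V : finType) (D : scomplex V)
    (e : rel V) (F : {set V}) :
  sr_ideal k D = edge_ideal k e ->
  (F \in faces D) = [forall u in F, forall v in F, ~~ e u v].
Proof.
move=> /faces_sr_ideal DE; apply/idP/idP => [/DE F0|indep].
  apply/forall_inP => u uF; apply/forall_inP => v vF; apply/negP => euv.
  have /eqP := F0 (xvar k u * xvar k v)
    (ex_intro _ u (ex_intro _ v (conj euv erefl))).
  by rewrite ind_eval_xvarM uF vF oner_eq0.
apply/DE => _ [u [v [euv ->]]].
rewrite ind_eval_xvarM.
case: (boolP (u \in F)) => //= uF; case: (boolP (v \in F)) => //= vF.
by have /forall_inP/(_ _ vF) := forall_inP indep _ uF; rewrite euv.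
Qed.

(** * Maximal chains of a graded poset *)

Section GradedPoset.
Variables (d : Order.disp_t) (P : finPOrderType d).
Implicit Types (p q : P) (C S : {set P}).

Lemma covers_lt p q : covers p q -> (p < q)%O.
Proof. by case/andP. Qed.

Lemma exists_cover p q : (p < q)%O -> exists2 z, covers p z & (z <= q)%O.
Proof.
move=> pq; pose Q z := (p < z)%O && (z <= q)%O.
have Qq : Q q by rewrite /Q pq lexx.
(* An element of the interval with the smallest strict down-set is minimal there, hence a cover of
   [p]. *)
case: (arg_minnP (fun z => #|[set y : P | (y < z)%O]%SET|) Qq).
move=> z /andP[pz zq] zmin; exists z => //; rewrite /covers pz.
apply/existsP => -[y /andP[py yz]].
have := zmin y; rewrite /Q py (le_trans (ltW yz) zq) => /(_ isT).
rewrite leqNgt proper_card //; apply/properP; split.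
  by apply/fintype.subsetP => x; rewrite !inE => /lt_trans; apply.
by exists y; rewrite !inE ?ltxx.
Qed.

Lemma max_eltsPn p : reflect (exists z, (p < z)%O) (p \notin max_elts P).
Proof. by rewrite !inE negbK; exact: existsP. Qed.

Variable rk : P -> nat.
Hypothesis rk_graded : is_rank_function rk.

(** Rank is constrained only along covers; replacing [p] by a cover below [q] shrinks its strict
    up-set, which drives the induction. *)
Lemma rk_lt p q : (p < q)%O -> (rk p < rk q)%N.
Proof.
have [n] := ubnP #|[set y | (p < y)%O]%SET|.
elim: n p => // n IHn p /ltnSE pn /exists_cover[z pz].
rewrite le_eqVlt => /orP[/eqP <-|zq]; first by rewrite (rk_graded.2 _ _ pz).
apply: ltn_trans (IHn z _ zq); first by rewrite (rk_graded.2 _ _ pz).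
apply: leq_trans pn; apply: proper_card; apply/properP; split.
  by apply/fintype.subsetP => x; rewrite !inE; apply: lt_trans (covers_lt pz).
by exists z; rewrite !inE ?ltxx ?covers_lt.
Qed.

Lemma rk_gt0 p : (0 < rk p)%N.
Proof.
case: (boolP (is_minimal p)) => [/rk_graded.1 ->//|].
by rewrite negbK => /existsP[z /rk_lt]; exact: leq_ltn_trans.
Qed.

Lemma is_chainP C :
  reflect {in C &, forall p q, (p <= q)%O || (q <= p)%O} (is_chain C).
Proof.
apply: (iffP forall_inP) => chC p => [q /chC/forall_inP + qC|pC]; first exact.
by apply/forall_inP => q; exact: chC.
Qed.

Lemma is_chainU1 C z : is_chain C ->
  {in C, forall c, (z <= c)%O || (c <= z)%O} -> is_chain (z |: C).
Proof.
move=> /is_chainP chC zC; apply/is_chainP => p q.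
rewrite !inE => /predU1P[->|pC] /predU1P[->|qC]; rewrite ?lexx ?zC //.
  by rewrite orbC zC.
exact: chC.
Qed.

Lemma maximal_chain_mem C z : is_maximal_chain C ->
  {in C, forall c, (z <= c)%O || (c <= z)%O} -> z \in C.
Proof.
case/maxsetP => chC maxC zC.
by rewrite -(maxC (z |: C)%SET) ?setU11 ?is_chainU1 // finset.subsetUr.
Qed.

Lemma maximal_chain_cover C p : is_maximal_chain C -> p \in C ->
  p \notin max_elts P -> exists2 q, q \in C & covers p q.
Proof.
move=> maxC pC /max_eltsPn[z pz].
have /is_chainP chC : is_chain C by case/maxsetP: maxC.
(* If [p] were the top of [C], then [z] could be added above it. *)
have /exists_inP[q0 q0C pq0] : [exists q in C, (p < q)%O].
  apply: contraT => noq.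
  have Cp c : c \in C -> (c <= p)%O.
    move=> cC; have := chC _ _ pC cC; rewrite le_eqVlt.
    case/orP => // /predU1P[->//|pc].
    by case/exists_inP: noq; exists c.
  have /Cp : z \in C.
    apply: maximal_chain_mem maxC _ => c /Cp cp.
    by rewrite (le_trans cp) ?orbT ?ltW.
  by move/(lt_le_trans pz); rewrite ltxx.
pose Q q := (q \in C) && (p < q)%O.
have Qq0 : Q q0 by apply/andP.
(* Take the next element of [C] above [p]: anything strictly between would be comparable with all of
   [C], hence in [C]. *)
case: (arg_minnP rk Qq0) => q /andP[qC pq] qmin.
exists q => //; rewrite /covers pq; apply/existsP => -[y /andP[py yq]].
suff yC : y \in C by have := qmin y; rewrite /Q yC py leqNgt rk_lt // => /(_ isT).
apply: maximal_chain_mem maxC _ => c cC.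
have := chC _ _ pC cC; rewrite orbC => /orP[cp|].
  by rewrite (ltW (le_lt_trans cp py)) orbT.
rewrite le_eqVlt => /predU1P[<-|pc]; first by rewrite (ltW py) orbT.
have := chC _ _ qC cC => /orP[qc|]; first by rewrite (ltW (lt_le_trans yq qc)).
rewrite le_eqVlt => /predU1P[->|/rk_lt cq]; first by rewrite ltW.
by have := qmin c; rewrite /Q cC pc leqNgt cq => /(_ isT).
Qed.

(** An element of least rank in [C] is minimal in [P], since anything below it could be added to
    [C]. *)
Lemma maximal_chain_rk1 C c0 : is_maximal_chain C -> c0 \in C ->
  exists2 p, p \in C & rk p = 1%N.
Proof.
move=> maxC c0C; have /is_chainP chC : is_chain C by case/maxsetP: maxC.
case: (arg_minnP rk c0C) => p pC pmin; exists p => //.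
apply: rk_graded.1; apply/existsP => -[z zp].
suff /pmin : z \in C by rewrite leqNgt rk_lt.
apply: maximal_chain_mem maxC _ => c cC; rewrite (le_trans (ltW zp)) //.
case/orP: (chC _ _ pC cC) => //; rewrite le_eqVlt => /predU1P[->//|/rk_lt].
by rewrite ltnNge pmin.
Qed.

(** In a larger chain, an element of rank at most [rk m] equals the element of [C] of that rank; one
    of higher rank would lie above the maximal [m]. *)
Lemma saturated_chain_maximal C m : is_chain C -> m \in C ->
  m \in max_elts P -> {in C, forall c, (c <= m)%O} ->
  (forall j, (0 < j <= rk m)%N -> exists2 c, c \in C & rk c = j) ->
  is_maximal_chain C.
Proof.
move=> chC mC mmax Cm Crk; apply/maxsetP; split=> // B /is_chainP chB CB.
apply/eqP; rewrite finset.eqEsubset CB andbT; apply/fintype.subsetP => z zB.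
have [zm|mz] := leqP (rk z) (rk m).
  have [|c cC rkc] := Crk (rk z); first by rewrite rk_gt0.
  case/orP: (chB _ _ zB (fintype.subsetP CB _ cC)); rewrite le_eqVlt.
    by move=> /predU1P[->//|/rk_lt]; rewrite rkc ltnn.
  by move=> /predU1P[<-//|/rk_lt]; rewrite rkc ltnn.
case/orP: (chB _ _ zB (fintype.subsetP CB _ mC)); rewrite le_eqVlt.
  by case/predU1P => [->//|/rk_lt]; rewrite ltnNge ltnW.
case/predU1P => [<-//|mz'].
by have /max_eltsPn : exists z, (m < z)%O by [exists z]; rewrite mmax.
Qed.

Lemma maximal_chain_in S p0 : p0 \in S ->
  {in S, forall p, p \notin max_elts P -> exists2 q, q \in S & covers p q} ->
  {in S, forall p, (1 < rk p)%N -> exists2 q, q \in S & covers q p} ->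
  exists2 C, is_maximal_chain C & C \subset S.
Proof.
move=> p0S up down.
(* Invariant of the climb: [C] has top [m] and meets every rank from 1 to [rk m]. *)
have extend n C m : (poset_rank rk - rk m < n)%N ->
    is_chain C -> C \subset S -> m \in C -> {in C, forall c, (c <= m)%O} ->
    (forall j, (0 < j <= rk m)%N -> exists2 c, c \in C & rk c = j) ->
    exists2 C, is_maximal_chain C & C \subset S.
  elim: n C m => // n IHn C m mn chC CS mC Cm Crk.
  case: (boolP (m \in max_elts P)) => [mmax|mnmax].
    by exists C => //; exact: saturated_chain_maximal mC mmax Cm Crk.
  have [q qS mq] := up m (fintype.subsetP CS _ mC) mnmax.
  have rkq := rk_graded.2 _ _ mq.
  have Cq c : c \in C -> (c <= q)%O.
    by move/Cm => /le_trans -> //; exact/ltW/covers_lt.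
  apply: (IHn (q |: C)%SET q).
  - have : (rk q <= poset_rank rk)%N by exact: leq_bigmax.
    by move: mn; rewrite rkq; lia.
  - by apply: is_chainU1 => // c /Cq ->; rewrite orbT.
  - by rewrite finset.subUset finset.sub1set qS.
  - exact: setU11.
  - by move=> c; rewrite !inE => /predU1P[->//|/Cq].
  move=> j; rewrite rkq => /andP[j0]; rewrite leq_eqVlt => /predU1P[->|].
    by exists q; rewrite ?setU11.
  rewrite ltnS => jm; have [|c cC <-] := Crk j; first by rewrite j0.
  by exists c; rewrite ?inE ?cC ?orbT.
case: (arg_minnP rk p0S) => p pS pmin.
have rkp : rk p = 1%N.
  apply/eqP; rewrite eqn_leq rk_gt0 andbT leqNgt; apply/negP => /(down _ pS).
  by move=> [q /pmin + /covers_lt/rk_lt]; rewrite leqNgt => /negP.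
apply: (extend _ [set p]%SET p (ltnSn _)).
- by apply/is_chainP => x y; rewrite !inE => /eqP -> /eqP ->; rewrite lexx.
- by rewrite finset.sub1set.
- exact: set11.
- by move=> c; rewrite inE => /eqP ->.
by move=> j; rewrite rkp => j1; exists p; [exact: set11|lia].
Qed.

End GradedPoset.

(** * The union of the layer graphs *)

Section LayerGraph.
Variables (d : Order.disp_t) (P : finPOrderType d) (rk : P -> nat).
Hypothesis rk_graded : is_rank_function rk.
Variables (r : nat) (A : {set P}).
Hypothesis rk_r : poset_rank rk = r.

(** An element of [A] tagged with a layer. In the layer of tag [i], lower vertices have rank [i.+1]
    and upper ones rank [i.+2]. *)
Definition cell : finType := {i : 'I_r.-1 & layer rk r A i.+1}%type.

Definition vert (x : cell) : P := val (tagged x).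

Definition cell_edge : rel cell :=
  fun x y => (tag x == tag y) && Gedge rk r A (vert x) (vert y).

Lemma Bpart_sub i : Bpart rk r A i \subset Apart rk A i.
Proof. by rewrite /Bpart; case: ifP => _; rewrite ?subsetDl. Qed.

Lemma in_Bpart i p : p \in Bpart rk r A i ->
  [/\ p \in A, rk p = i & (1 < i < r)%N -> p \notin max_elts P].
Proof.
move=> pB; have := fintype.subsetP (Bpart_sub i) _ pB.
rewrite inE => /andP[-> /eqP]; split=> // ir.
move: pB; rewrite /Bpart ifT; first by rewrite finset.in_setD; case/andP.
by move: ir; lia.
Qed.

Lemma vertP (x : cell) :
  vert x \in Bpart rk r A (tag x).+1 \/
  (vert x \in A /\ rk (vert x) = (tag x).+2).
Proof.
have := valP (tagged x); rewrite inE => /orP[xB|]; first by left.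
by rewrite inE => /andP[? /eqP ?]; right.
Qed.

Lemma vert_A x : vert x \in A.
Proof. by case: (vertP x) => [/in_Bpart[]|[]]. Qed.

Lemma exists_cell (i : 'I_r.-1) p :
  p \in Bpart rk r A i.+1 :|: Apart rk A i.+2 ->
  exists2 x : cell, vert x = p & tag x = i.
Proof.
move=> pL; pose u : layer rk r A i.+1 := exist _ p pL.
by exists (Tagged (fun j : 'I_r.-1 => layer rk r A j.+1 : Type) u).
Qed.

Lemma lower_cell p : p \in A -> p \notin max_elts P ->
  exists2 x : cell, vert x = p & rk p = (tag x).+1.
Proof.
move=> pA pmax; have rkp0 := rk_gt0 rk_graded p.
have pr : (rk p < r)%N.
  have /max_eltsPn[z /(rk_lt rk_graded) pz] := pmax.
  by apply: leq_trans pz _; rewrite -rk_r; exact: leq_bigmax.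
have ip : ((rk p).-1 < r.-1)%N by lia.
have pL : p \in Bpart rk r A (rk p).-1.+1 :|: Apart rk A (rk p).-1.+2.
  rewrite prednK // inE /Bpart; case: ifP; rewrite !inE pA eqxx //= => _.
  by move: pmax; rewrite !inE => ->.
by have [x xp xi] := @exists_cell (Ordinal ip) p pL; exists x; rewrite ?xi ?prednK.
Qed.

Lemma upper_cell p : p \in A -> (1 < rk p)%N ->
  exists2 x : cell, vert x = p & rk p = (tag x).+2.
Proof.
move=> pA p1.
have pr : (rk p <= r)%N by rewrite -rk_r; exact: leq_bigmax.
have ip : ((rk p).-2 < r.-1)%N by lia.
have rkE : (rk p).-2.+2 = rk p by lia.
have pL : p \in Bpart rk r A (rk p).-2.+1 :|: Apart rk A (rk p).-2.+2.
  by rewrite rkE !inE pA eqxx orbT.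
by have [x xp xi] := @exists_cell (Ordinal ip) p pL; exists x; rewrite ?xi.
Qed.

Lemma up_edgeP p q : up_edge rk r A p q -> covers p q /\ rk q = (rk p).+1.
Proof. by case/existsP => i /and4P[_ _ _ pq]; rewrite (rk_graded.2 _ _ pq). Qed.

Lemma cell_edge_sym : symmetric cell_edge.
Proof. by move=> x y; rewrite /cell_edge /Gedge eq_sym orbC. Qed.

Lemma cell_edge_covers (x y : cell) : tag x = tag y ->
  vert x \in Bpart rk r A (tag x).+1 -> covers (vert x) (vert y) ->
  cell_edge x y.
Proof.
move=> txy xB xy; rewrite /cell_edge txy eqxx /=; apply/orP; left.
have xr : ((tag x).+1 < r)%N by move: (ltn_ord (tag x)); lia.
apply/existsP; exists (Ordinal xr) => /=; rewrite xB xy andbT inE vert_A /=.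
by rewrite (rk_graded.2 _ _ xy); have [_ ->] := in_Bpart xB.
Qed.

(** Ranks in a layer take only two values, so an edge at an upper vertex can only lead down. *)
Lemma upper_cell_edge (x y : cell) : rk (vert x) = (tag x).+2 ->
  cell_edge x y -> covers (vert y) (vert x).
Proof.
move=> rkx /andP[/eqP txy] /orP[] /up_edgeP[] // _.
by case: (vertP y) => [/in_Bpart[_ -> _]|[_ ->]]; rewrite rkx txy; lia.
Qed.

Lemma lower_cell_edge (x y : cell) : rk (vert x) = (tag x).+1 ->
  cell_edge x y -> covers (vert x) (vert y).
Proof.
move=> rkx /andP[/eqP txy] /orP[] /up_edgeP[] // _.
by case: (vertP y) => [/in_Bpart[_ -> _]|[_ ->]]; rewrite rkx txy; lia.
Qed.

Hypothesis A_nonisolated : (1 < r)%N ->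
  forall p : P, p \in A -> rk p = 1%N -> p \notin max_elts P.

(** From rank 2 on, [Bpart] has lost its maximal elements; in rank 1 it has not, and [A_nonisolated]
    takes over. *)
Lemma Bpart_nonmax i p : (i.+1 < r)%N -> p \in Bpart rk r A i.+1 ->
  p \notin max_elts P.
Proof.
move=> ir /in_Bpart[pA rkp]; case: i => [|i] in ir rkp *; last by apply; lia.
by move=> _; exact: A_nonisolated.
Qed.

Lemma independent_no_chain (F : {set cell}) : F != finset.set0 ->
  {in F &, forall x y, ~~ cell_edge x y} ->
  ~~ [exists C : {set P}, is_maximal_chain C && (C \subset vert @: F)].
Proof.
case/set0Pn => x0 x0F indep; apply/existsP => -[C /andP[maxC CF]].
have [c0 c0C] : exists c, c \in C.
  apply/set0Pn/eqP => C0; move: (maximal_chain_mem (z := vert x0) maxC).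
  by rewrite C0 inE => /(_ _)/notF; apply => c; rewrite inE.
pose Q (x : cell) := [&& x \in F, vert x \in C & vert x \in Bpart rk r A (tag x).+1].
(* Upper vertices have rank at least 2, so a cell over the rank-1 element of [C] is lower. *)
have [x1 Qx1] : exists x, Q x.
  have [p pC rkp] := maximal_chain_rk1 rk_graded maxC c0C.
  have /imsetP[x xF px] := fintype.subsetP CF _ pC.
  exists x; rewrite /Q xF -px pC px.
  by case: (vertP x) => // -[_]; rewrite -px rkp.
(* Take the highest lower cell [x] over [C]. A cell of [F] over the next element of [C] is either
   lower, against this choice, or upper in the layer of [x], hence adjacent to [x]. *)
case: (arg_maxnP (fun x => rk (vert x)) Qx1) => x /and3P[xF xC xB] xmax.
have xr : ((tag x).+1 < r)%N by move: (ltn_ord (tag x)); lia.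
have [q qC xq] := maximal_chain_cover rk_graded maxC xC (Bpart_nonmax xr xB).
have /imsetP[y yF qy] := fintype.subsetP CF _ qC.
have rkq := rk_graded.2 _ _ xq; have [_ rkx _] := in_Bpart xB.
case: (vertP y) => [yB|[_ rky]].
  have := xmax y; rewrite /Q yF -qy qC qy yB => /(_ isT).
  by rewrite -qy rkq /= ltnn.
have /negP[] := indep _ _ xF yF; apply: cell_edge_covers => //; last by rewrite -qy.
by apply: val_inj; move: rky; rewrite -qy rkq rkx => -[].
Qed.

(** If every cell over [S] had a neighbour over [S], lower copies would yield covers in [S] going up
    and upper copies covers going down, and [S] would contain a maximal chain. *)
Lemma isolated_cell (S : {set P}) : S != finset.set0 -> S \subset A ->
  ~~ [exists C : {set P}, is_maximal_chain C && (C \subset S)] ->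
  exists2 w : cell, vert w \in S &
    forall x, vert x \in S -> ~~ cell_edge w x.
Proof.
case/set0Pn => p0 p0S /fintype.subsetP SA noC.
have [|noiso] := pselect (exists2 w : cell, vert w \in S &
    forall x, vert x \in S -> ~~ cell_edge w x) => //.
have nbr (w : cell) : vert w \in S -> exists2 x, vert x \in S & cell_edge w x.
  move=> wS; apply/exists_inP; apply: contraT => nonbr.
  case: noiso; exists w => // x xS.
  by apply: contra nonbr => wx; apply/exists_inP; exists x.
have [p pS pmax|p pS p1|C maxC CS] := maximal_chain_in rk_graded p0S (S := S).
- have [w wp rkw] := lower_cell (SA _ pS) pmax.
  have [|x xS wx] := nbr w; first by rewrite wp.
  by exists (vert x) => //; rewrite -wp; apply: lower_cell_edge wx; rewrite wp.
- have [w wp rkw] := upper_cell (SA _ pS) p1.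
  have [|x xS wx] := nbr w; first by rewrite wp.
  by exists (vert x) => //; rewrite -wp; apply: upper_cell_edge wx; rewrite wp.
by case/existsP: noC; exists C; rewrite maxC.
Qed.

End LayerGraph.

(** * Maps between realizations *)

Section RealContinuity.
Variables (R : realType) (T : topologicalType).
Implicit Types f g : T -> R.

Lemma continuous_add f g : continuous f -> continuous g ->
  continuous (fun x => f x + g x).
Proof. by move=> cf cg x; exact: cvgD (cf x) (cg x). Qed.

Lemma continuous_sub f g : continuous f -> continuous g ->
  continuous (fun x => f x - g x).
Proof. by move=> cf cg x; exact: cvgB (cf x) (cg x). Qed.

Lemma continuous_mul f g : continuous f -> continuous g ->
  continuous (fun x => f x * g x).
Proof. by move=> cf cg x; exact: cvgM (cf x) (cg x). Qed.

Lemma continuous_minr f g : continuous f -> continuous g ->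
  continuous (fun x => Num.min (f x) (g x)).
Proof. by move=> cf cg x; exact: (continuous_min (cf x) (cg x)). Qed.

Lemma continuous_maxr f g : continuous f -> continuous g ->
  continuous (fun x => Num.max (f x) (g x)).
Proof. by move=> cf cg x; exact: (continuous_max (cf x) (cg x)). Qed.

Lemma continuous_sum (I : finType) (Q : pred I) (F : I -> T -> R) :
  (forall i, continuous (F i)) -> continuous (fun x => \sum_(i | Q i) F i x).
Proof. by move=> cF; apply: continuous_big => //; exact: add_continuous. Qed.

Lemma continuous_prod (I : finType) (Q : pred I) (F : I -> T -> R) :
  (forall i, continuous (F i)) -> continuous (fun x => \prod_(i | Q i) F i x).
Proof. by move=> cF; apply: continuous_big => //; exact: mul_continuous. Qed.

End RealContinuity.

Section RealizationMaps.
Variables (R : realType) (V : finType) (D : scomplex V).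

Lemma coord_continuous (v : V) :
  continuous (fun t : realization R D => (val t : {ptws V -> R}) v).
Proof.
move=> t; apply: (@continuous_comp _ _ _ (fun t : realization R D => set_val t)
  (fun u : {ptws V -> R} => u v)); first exact: initial_continuous.
exact: (@proj_continuous _ (fun=> R) v).
Qed.

Lemma continuous_realization (T : topologicalType) (u : T -> V -> R) :
  (forall x, realization R D (u x)) -> (forall v, continuous (fun x => u x v)) ->
  exists2 g : T -> realization R D, continuous g & forall x, val (g x) = u x.
Proof.
move=> uD cu; exists (fun x => SigSub (mem_set (uD x))) => //.
apply: continuous_comp_initial => x.
apply/cvg_sup => v.
by apply: (@continuous_comp_initial (V -> R) T R (fun f => f v) u); exact: cu.
Qed.

Lemma homotopic_realization (T : topologicalType) (f g : T -> realization R D)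
    (u : T * R -> V -> R) :
  (forall x s, 0 <= s <= 1 -> realization R D (u (x, s))) ->
  (forall x s v, 0 <= s <= 1 -> {for (x, s), continuous (fun z => u z v)}) ->
  (forall x, u (x, 0) = val (f x)) -> (forall x, u (x, 1) = val (g x)) ->
  homotopic R f g.
Proof.
move=> uD cu u0 u1.
(* [homotopic] asks for a map on all of [T * R]; clamping the time means that [u] matters only over
   [0,1]. *)
pose clamp (z : T * R) := (z.1, Num.max 0 (Num.min 1 z.2)).
have cclamp : continuous clamp.
  suff c2 : continuous (fun z : T * R => Num.max 0 (Num.min 1 z.2)).
    by move=> z; exact: cvg_pair (@cvg_fst _ _ _ _ _) (c2 z).
  apply: (@continuous_maxr _ _ (fun=> 0)); first exact: cst_continuous.
  apply: (@continuous_minr _ _ (fun=> 1)); first exact: cst_continuous.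
  by move=> y; exact: cvg_snd.
have clamp01 z : 0 <= (clamp z).2 <= 1.
  by rewrite le_max lexx /= ge_max ler01 /= ge_min lexx.
have [||H cH HE] := @continuous_realization _ (fun z => u (clamp z)).
- by move=> z; exact: uD (clamp01 z).
- move=> v z; apply: (@continuous_comp _ _ _ clamp (fun y => u y v)).
    exact: cclamp.
  exact: cu (clamp01 z).
exists H; split=> [|x|x]; first exact: continuous_subspaceT.
  by apply: val_inj; rewrite HE -u0 /clamp /= (min_idPr ler01) maxxx.
by apply: val_inj; rewrite HE -u1 /clamp /= minxx (max_idPr ler01).
Qed.

Lemma realization_normalize (u : V -> R) :
  (forall v, 0 <= u v) -> 0 < \sum_v u v -> [set v | u v != 0]%SET \in faces D ->
  realization R D (fun v => u v / \sum_w u w).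
Proof.
move=> u0 usum uD; split=> [v||].
- by rewrite divr_ge0 // ltW.
- by rewrite -mulr_suml divff ?gt_eqF.
apply: faces_down uD _; apply/fintype.subsetP => v; rewrite !inE.
by apply: contra => /eqP ->; rewrite mul0r.
Qed.

End RealizationMaps.

(** * Simplicial maps onto a complex with conical fibers *)

Section FlagFibers.
Variables (R : realType) (V W : finType) (K : scomplex V) (J : scomplex W).
Variables (E : rel W) (pi : W -> V).
Hypothesis E_sym : symmetric E.
Hypothesis J_flag : forall F : {set W},
  reflect {in F &, forall x y, ~~ E x y} (F \in faces J).
Hypothesis pi_face : forall F : {set W}, F != finset.set0 -> F \in faces J ->
  pi @: F \in faces K.
Hypothesis K_apex : forall S : {set V}, S != finset.set0 -> S \in faces K ->
  exists2 w, pi w \in S & forall x, pi x \in S -> ~~ E w x.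

(** By [J_flag], an apex can be joined to every face of [J] over [S]: it is a cone point of the
    preimage of the simplex [S]. *)
Definition apex (S : {set V}) (w : W) : bool :=
  (pi w \in S) && [forall x, (pi x \in S) ==> ~~ E w x].

Lemma apexP S w : apex S w ->
  pi w \in S /\ forall x, pi x \in S -> ~~ E w x.
Proof.
by case/andP => wS /forallP iso; split=> // x xS; exact: (implyP (iso x)).
Qed.

Lemma apex_exists S : S != finset.set0 -> S \in faces K -> exists w, apex S w.
Proof.
move=> S0 SK; have [w wS iso] := K_apex S0 SK.
by exists w; rewrite /apex wS; apply/forallP => x; apply/implyP; exact: iso.
Qed.

Definition push (t : W -> R) (v : V) : R := \sum_(w | pi w == v) t w.

Lemma push_ge (t : W -> R) w : (forall w, 0 <= t w) -> t w <= push t (pi w).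
Proof.
move=> t0; rewrite /push (bigD1 w) //= lerDl sumr_ge0 //.
Qed.

Lemma push_neq0 (t : W -> R) v : push t v != 0 -> exists2 w, pi w = v & t w != 0.
Proof.
move=> tv; have /exists_inP[w /eqP wv tw] : [exists (w | pi w == v), t w != 0].
  apply: contraT => /exists_inPn t0; case/eqP: tv.
  by apply: big1 => w /t0; rewrite negbK => /eqP.
by exists w.
Qed.

Lemma push_realization (t : W -> R) :
  realization R J t -> realization R K (push t).
Proof.
move=> [t0 t1 tJ]; split=> [v||].
- exact: sumr_ge0.
- by rewrite -t1 (partition_big pi xpredT).
apply: faces_down (pi_face _ tJ) _; last first.
  apply/fintype.subsetP => v; rewrite inE => /push_neq0[w <- tw].
  by apply: imset_f; rewrite inE.
apply/set0Pn; have /existsP[w tw] : [exists w, t w != 0].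
  apply: contraT => /existsPn t00; have /eqP := oner_neq0 R; case.
  by rewrite -t1 big1 // => w _; apply/eqP; rewrite -[_ == _]negbK t00.
by exists w; rewrite inE.
Qed.

(* For 0 < s this is nonzero exactly when S is an upper level set of T, inside
   the support of T, with T < s outside S.  For s = 1 and S nonempty these are,
   up to positive factors, the coordinates of T in the barycentric subdivision
   of K; the empty set may have nonzero weight, but it has no apex. *)
Definition level_weight (s : R) (S : {set V}) (T : V -> R) : R :=
  s * (\prod_(p in S) T p) *
  (\prod_(p in S) \prod_(q in ~: S) Num.max 0 (T p - T q)) *
  (\prod_(q in ~: S) Num.max 0 (s - T q)).

Lemma level_weight_ge0 s S T : 0 <= s -> (forall v, 0 <= T v) ->
  0 <= level_weight s S T.
Proof.
move=> s0 T0; rewrite !mulr_ge0 ?prodr_ge0 // => [p _|q _].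
  by apply: prodr_ge0 => q _; rewrite le_max lexx.
by rewrite le_max lexx.
Qed.

Lemma maxr0_neq0 (x : R) : (Num.max 0 x != 0) = (0 < x).
Proof. by case: ltP => [/gt_eqF->//|]; rewrite eqxx. Qed.

Lemma level_weight_neq0 s S T : level_weight s S T != 0 <->
  [/\ s != 0, {in S, forall p, T p != 0},
      {in S & ~: S, forall p q, T q < T p} & {in ~: S, forall q, T q < s}].
Proof.
rewrite !mulf_eq0 !negb_or -!andbA; split.
  case/and4P => -> /prodf_neq0 TS /prodf_neq0 lt1 /prodf_neq0 lt2; split=> //.
    move=> p q pS qS; have /prodf_neq0 /(_ _ qS) := lt1 p pS.
    by rewrite maxr0_neq0 subr_gt0.
  by move=> q /lt2; rewrite maxr0_neq0 subr_gt0.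
case=> -> TS lt1 lt2 /=; apply/and3P; split; apply/prodf_neq0 => //.
  move=> p pS; apply/prodf_neq0 => q qS.
  by rewrite maxr0_neq0 subr_gt0 lt1.
by move=> q qS; rewrite maxr0_neq0 subr_gt0 lt2.
Qed.

(** Incomparable level sets would give [T q < T p < T q]. *)
Lemma level_weight_chain s S1 S2 T : level_weight s S1 T != 0 ->
  level_weight s S2 T != 0 -> (S1 \subset S2) || (S2 \subset S1).
Proof.
move=> /level_weight_neq0[_ _ lt1 _] /level_weight_neq0[_ _ lt2 _].
apply: contraT; rewrite negb_or => /andP[/subsetPn[p p1 p2] /subsetPn[q q2 q1]].
by have := lt_trans (lt1 p q p1 _) (lt2 q p q2 _); rewrite !inE ltxx; apply.
Qed.

(** The set where [T] attains its maximum serves; it keeps the total weight nonzero when no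
    coordinate exceeds [s]. *)
Lemma level_weight_top s (T : V -> R) :
  (forall v, T v <= s) -> (forall v, 0 <= T v) -> (exists v, T v != 0) ->
  exists S, [/\ S != finset.set0, {in S, forall v, T v != 0}
    & 0 < level_weight s S T].
Proof.
move=> Ts T0 [v0 Tv0]; pose S := [set v | [forall u, T u <= T v]]%SET.
have [m Tm] : exists m, forall u, T u <= T m.
  have [m _ mmax] := @arg_maxP _ _ _ v0 xpredT T isT.
  by exists m => u; exact: mmax.
have Tm0 : 0 < T m by apply: lt_le_trans (Tm v0); rewrite lt_def Tv0 T0.
have s0 : 0 < s := lt_le_trans Tm0 (Ts m).
have Smax p : p \in S -> T p = T m.
  by rewrite inE => /forallP/(_ m) mp; apply/eqP; rewrite eq_le Tm mp.
have Slt q : q \in ~: S -> T q < T m.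
  rewrite !inE => /forallPn[u]; rewrite -ltNge => /lt_le_trans; apply; exact: Tm.
have TS p : p \in S -> T p != 0 by move=> /Smax ->; rewrite gt_eqF.
exists S; split=> //.
  by apply/set0Pn; exists m; rewrite inE; apply/forallP.
rewrite lt_def level_weight_ge0 ?ltW // andbT; apply/level_weight_neq0.
split=> //; first by rewrite gt_eqF.
  by move=> p q /Smax -> /Slt.
by move=> q /Slt Tq; exact: lt_le_trans Tq (Ts m).
Qed.

(** Each level set gives its weight to all of its apexes, so that none has to be chosen. *)
Definition mix (s : R) (a : W -> R) (T : V -> R) (w : W) : R :=
  a w + \sum_(S : {set V} | apex S w) level_weight s S T.

Definition mixn (s : R) (a : W -> R) (T : V -> R) (w : W) : R :=
  mix s a T w / \sum_x mix s a T x.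

Section Mix.
Variables (s : R) (a : W -> R) (T : V -> R).
Hypotheses (s0 : 0 <= s) (a0 : forall w, 0 <= a w) (TK : realization R K T).
Hypothesis a_face : [set w | a w != 0]%SET \in faces J.
Hypothesis a_above : forall w, a w != 0 -> s < T (pi w).
Hypothesis a_pos : forall p, s < T p -> exists w, a w != 0.

Let T0 v : 0 <= T v. Proof. by case: TK. Qed.

Lemma mix_ge0 w : 0 <= mix s a T w.
Proof. by rewrite addr_ge0 // sumr_ge0 // => S _; exact: level_weight_ge0. Qed.

Lemma mix_neq0 w : mix s a T w != 0 ->
  a w != 0 \/ exists2 S, apex S w & level_weight s S T != 0.
Proof.
move=> mw; case: (boolP (a w != 0)) => [|/negPn/eqP aw]; first by left.
right; apply/exists_inP; apply: contraT => /exists_inPn S0; case/eqP: mw.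
rewrite /mix aw add0r; apply: big1 => S /S0.
by rewrite negbK => /eqP.
Qed.

(** Either [T] exceeds [s] somewhere and [a] is nonzero, or the top level set has positive weight
    and an apex. *)
Lemma mix_gt0 : 0 < \sum_w mix s a T w.
Proof.
suff [w mw] : exists w, 0 < mix s a T w.
  rewrite (bigD1 w) //= ltr_wpDr // sumr_ge0 // => x _; exact: mix_ge0.
have [/existsP[p /a_pos[w aw]]|/existsPn Ts] := boolP [exists p, s < T p].
  exists w; rewrite ltr_wpDr ?sumr_ge0 //.
    by move=> S _; exact: level_weight_ge0.
  by rewrite lt_def aw a0.
have [|||S [S0 ST wS]] := @level_weight_top s T => //.
- by move=> v; rewrite leNgt.
- have [_ T1 _] := TK; apply/existsP; apply: contraT => /existsPn T00.
  have /eqP := oner_neq0 R; case; rewrite -T1 big1 // => w _.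
  by apply/eqP; rewrite -[_ == _]negbK T00.
have [_ _ TK'] := TK.
have [|w wap] := apex_exists S0.
  apply: faces_down TK' _; apply/fintype.subsetP => v /ST.
  by rewrite inE.
exists w; rewrite ltr_wpDl // (bigD1 S) //= ltr_wpDr // sumr_ge0 // => S' _.
exact: level_weight_ge0.
Qed.

(* An apex of a level set S is isolated from every cell over S, in particular
   from the apexes of smaller level sets, and from the support of a as soon as
   that lies over S; this is what the threshold s ensures. *)
Lemma mix_face : [set w | mix s a T w != 0]%SET \in faces J.
Proof.
apply/J_flag => x y; rewrite !inE => /mix_neq0 mx /mix_neq0 my.
have aE w S : a w != 0 -> level_weight s S T != 0 -> pi w \in S.
  move=> /a_above sw /level_weight_neq0[_ _ _ lts].
  by apply: contraT => wS; move: sw; rewrite ltNge ltW // lts // inE.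
case: mx my => [ax|[S /apexP[xS xiso] wS]] [ay|[S' /apexP[yS' yiso] wS']].
- by move/J_flag: a_face; apply; rewrite inE.
- by rewrite E_sym; apply/yiso/aE.
- exact/xiso/aE.
case/orP: (level_weight_chain wS wS') => /fintype.subsetP sub.
  by rewrite E_sym; apply/yiso/sub.
exact/xiso/sub.
Qed.

Lemma mixn_realization : realization R J (mixn s a T).
Proof. exact: realization_normalize mix_ge0 mix_gt0 mix_face. Qed.

End Mix.

Lemma mix_continuous (T : topologicalType) (s : T -> R) (a : T -> W -> R)
    (t : T -> V -> R) (w : W) :
  continuous s -> (forall w, continuous (fun x => a x w)) ->
  (forall v, continuous (fun x => t x v)) ->
  continuous (fun x => mix (s x) (a x) (t x) w).
Proof.
move=> cs ca ct; apply: continuous_add => //; apply: continuous_sum => S.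
have c0 : continuous ((fun=> 0) : T -> R) by exact: cst_continuous.
apply: continuous_mul; [apply: continuous_mul; [apply: continuous_mul|]|] => //.
- exact: continuous_prod.
- apply: continuous_prod => p; apply: continuous_prod => q.
  by apply: continuous_maxr => //; exact: continuous_sub.
- apply: continuous_prod => q; apply: continuous_maxr => //.
  exact: continuous_sub.
Qed.

Lemma mixn_continuous (T : topologicalType) (s : T -> R) (a : T -> W -> R)
    (t : T -> V -> R) (w : W) (x : T) :
  continuous s -> (forall w, continuous (fun x => a x w)) ->
  (forall v, continuous (fun x => t x v)) ->
  0 < \sum_w mix (s x) (a x) (t x) w ->
  {for x, continuous (fun x => mixn (s x) (a x) (t x) w)}.
Proof.
move=> cs ca ct sum0; apply: continuousM; first exact: mix_continuous.
apply: continuousV; first by rewrite gt_eqF.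
by apply: continuous_sum => y; exact: mix_continuous.
Qed.

(* At threshold s only the part of t lying over the points where push t
   exceeds s is kept, and only the level sets of push t containing those points
   are used, so that both parts together stay in a face. *)
Definition fiber_homotopy (s : R) (t : W -> R) : W -> R :=
  mixn s (fun w => Num.min (t w) (Num.max 0 (push t (pi w) - s))) (push t).

(** The truncation of [t] satisfies what section [Mix] requires of [a]. *)
Lemma fiber_homotopy_spec s t : realization R J t -> 0 <= s ->
  let a w := Num.min (t w) (Num.max 0 (push t (pi w) - s)) in
  [/\ forall w, 0 <= a w, [set w | a w != 0]%SET \in faces J,
      forall w, a w != 0 -> s < push t (pi w) &
      forall p, s < push t p -> exists w, a w != 0].
Proof.
move=> tJ s0 a; have [t0 _ tF] := tJ.
have aE w : (a w != 0) = (t w != 0) && (s < push t (pi w)).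
  rewrite -subr_gt0 -maxr0_neq0 /a; set m := Num.max _ _.
  have m0 : 0 <= m by rewrite le_max lexx.
  case: leP => [tm|mt].
    case: (boolP (t w != 0)) => //= tw; rewrite gt_eqF //.
    by apply: lt_le_trans tm; rewrite lt_def tw t0.
  by have /gt_eqF -> : 0 < t w := le_lt_trans m0 mt.
split=> [w||w|p sp].
- by rewrite le_min t0 le_max lexx.
- apply: faces_down tF _; apply/fintype.subsetP => w; rewrite !inE aE.
  by case/andP.
- by rewrite aE => /andP[].
have /push_neq0[w wp tw] : push t p != 0 by rewrite gt_eqF // (le_lt_trans s0).
by exists w; rewrite aE tw wp.
Qed.

(** The factor [s] kills all level weights, and by [push_ge] the truncation leaves [t] unchanged. *)
Lemma fiber_homotopy0 t : realization R J t -> fiber_homotopy 0 t = t.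
Proof.
move=> [t0 t1 _].
have mixE w : mix 0 (fun w => Num.min (t w) (Num.max 0 (push t (pi w) - 0)))
    (push t) w = t w.
  rewrite /mix big1 ?addr0 => [|S _]; last by rewrite /level_weight !mul0r.
  by rewrite subr0; apply/min_idPl; rewrite le_max push_ge ?orbT.
apply/funext => w; rewrite /fiber_homotopy /mixn mixE.
by under eq_bigr do rewrite mixE; rewrite t1 divr1.
Qed.

(** Coordinates of [push t] are at most 1, so nothing survives the truncation. *)
Lemma fiber_homotopy1 t : realization R J t ->
  fiber_homotopy 1 t = mixn 1 (fun=> 0) (push t).
Proof.
move=> tJ; have [t0 _ _] := tJ; have [T0 T1 _] := push_realization tJ.
congr (mixn _ _ _); apply/funext => w.
rewrite max_l ?min_r // subr_le0 -T1 (bigD1 (pi w)) //= lerDl sumr_ge0 //.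
Qed.

Theorem flag_fibers_homotopy_equivalent : complex_homotopy_equivalent R K J.
Proof.
pose Tc (T : realization R K) : V -> R := val T.
pose tc (t : realization R J) : W -> R := val t.
(* No coordinate of [T] exceeds 1, so at threshold 1 the zero function is an admissible [a]. *)
have zero_ok (T : V -> R) : realization R K T ->
    [/\ realization R J (mixn 1 (fun=> 0) T) & 0 < \sum_w mix 1 (fun=> 0) T w].
  move=> TK; have T1 p : (1 < T p) = false.
    have [T0 T1 _] := TK; apply/negbTE; rewrite -leNgt -T1 (bigD1 p) //= lerDl.
    by rewrite sumr_ge0.
  have z0 : [set w : W | (0 : R) != 0]%SET \in faces J.
    by apply/J_flag => x y; rewrite !inE eqxx.
  split; [apply: mixn_realization|apply: mix_gt0] => //.
  - by move=> w; rewrite eqxx.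
  - by move=> p; rewrite T1.
  - by move=> p; rewrite T1.
have [||f cf fE] := @continuous_realization R W J (realization R K)
    (fun T => mixn 1 (fun=> 0) (Tc T)).
- by move=> T; have [] := zero_ok _ (set_valP T).
- move=> w T; apply: mixn_continuous.
  + exact: cst_continuous.
  + by move=> ?; exact: cst_continuous.
  + exact: coord_continuous.
  + by have [] := zero_ok _ (set_valP T).
have [||g cg gE] := @continuous_realization R V K (realization R J)
    (fun t => push (tc t)).
- by move=> t; exact: push_realization (set_valP t).
- by move=> v; apply: continuous_sum => w; exact: coord_continuous.
exists f, g; split=> //.
(* The straight-line homotopy stays in [K]: the apexes used for [T] lie over its support, so
   [g (f T)] is supported inside the support of [T]. *)
- apply: (@homotopic_realization R V K (realization R K) _ _
    (fun z v => (1 - z.2) * Tc (g (f z.1)) v + z.2 * Tc z.1 v)).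
  + move=> T s /andP[s0 s1] /=; have [p0 p1 _] := set_valP (g (f T)).
    have [T0 T1 TF] := set_valP T; split=> [v||].
    * by rewrite addr_ge0 ?mulr_ge0 ?subr_ge0.
    * rewrite big_split /= -!mulr_sumr [X in _ * X + _]p1 [X in _ + _ * X]T1.
      by rewrite !mulr1 subrK.
    apply: faces_down TF _; apply/fintype.subsetP => v; rewrite !inE.
    apply: contra => /eqP Tv; rewrite [Tc T v]Tv mulr0 addr0 mulf_eq0.
    apply/orP; right; rewrite /Tc gE /tc fE.
    apply: contraT => /push_neq0[w wv].
    rewrite mulf_eq0 negb_or => /andP[/mix_neq0[]]; first by rewrite eqxx.
    move=> [S /apexP[wS _] /level_weight_neq0[_ TS _ _]] _.
    by have := TS _ wS; rewrite wv [Tc T v]Tv eqxx.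
  + move=> T s v _; apply: continuous_add.
      apply: continuous_mul.
        apply: continuous_sub => [|z]; [exact: cst_continuous|exact: cvg_snd].
      move=> z; apply: (@continuous_comp _ _ _ (fun z => g (f z.1)) (Tc^~ v)).
        apply: (@continuous_comp _ _ _ fst (g \o f)); first exact: cvg_fst.
        by apply: continuous_comp; [exact: cf|exact: cg].
      exact: coord_continuous.
    apply: continuous_mul => z; first exact: cvg_snd.
    apply: (@continuous_comp _ _ _ fst (Tc^~ v)); first exact: cvg_fst.
    exact: coord_continuous.
  + by move=> T; apply/funext => v; rewrite subr0 mul1r mul0r addr0.
  + by move=> T; apply/funext => v; rewrite subrr mul0r mul1r add0r.
(* The threshold falls from 1, where the point is [f (g t)], to 0, where it is [t]. *)
apply: (@homotopic_realization R W J (realization R J) _ _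
  (fun z => fiber_homotopy (1 - z.2) (tc z.1))).
- move=> t s /andP[s0 s1]; have tJ := set_valP t.
  have s'0 : 0 <= 1 - s by rewrite subr_ge0.
  have [a0 aF aa ap] := fiber_homotopy_spec tJ s'0.
  by apply: mixn_realization => //; exact: push_realization.
- move=> t s w /andP[s0 s1]; have tJ := set_valP t.
  have s'0 : 0 <= 1 - s by rewrite subr_ge0.
  have [a0 aF aa ap] := fiber_homotopy_spec tJ s'0.
  have ct x : continuous (fun z : realization R J * R => tc z.1 x).
    move=> z; apply: (@continuous_comp _ _ _ fst (tc^~ x)); first exact: cvg_fst.
    exact: coord_continuous.
  have cs : continuous (fun z : realization R J * R => 1 - z.2).
    by apply: continuous_sub => [|z]; [exact: cst_continuous|exact: cvg_snd].
  have cT v : continuous (fun z : realization R J * R => push (tc z.1) v).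
    exact: continuous_sum.
  apply: mixn_continuous => //; last first.
    by apply: mix_gt0 => //; exact: push_realization.
  move=> x; apply: continuous_minr => //; apply: continuous_maxr.
    exact: cst_continuous.
  exact: continuous_sub.
- by move=> t; rewrite subr0 (fiber_homotopy1 (set_valP t)) /= fE /Tc gE.
- by move=> t; rewrite subrr (fiber_homotopy0 (set_valP t)).
Qed.

End FlagFibers.

(** * The join as an independence complex, and the conclusion *)

Lemma join_edge_ideal_faces (k : fieldType) (d : Order.disp_t)
    (P : finPOrderType d) (rk : P -> nat) (r : nat) (A : {set P})
    (X : forall i : 'I_r.-1, scomplex (layer rk r A i.+1))
    (X_edge : forall i : 'I_r.-1,
       sr_ideal k (X i) = edge_ideal k (Glayer rk r A i.+1))
    (F : {set cell rk r A}) :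
  reflect {in F &, forall x y, ~~ cell_edge x y} (F \in faces (join_complex X)).
Proof.
(* Cells with different tags are never adjacent, so independence can be tested layer by layer. *)
rewrite inE; apply: (iffP forallP) => [FX [i u] [j v] xF yF|indep i].
  rewrite /cell_edge /=; case: eqVneq => //= ij.
  case: j / ij in v yF *.
  have := FX i; rewrite (faces_edge_ideal _ (X_edge i)) => /forall_inP/(_ u).
  by rewrite inE => /(_ xF)/forall_inP/(_ v); rewrite inE; apply.
rewrite (faces_edge_ideal _ (X_edge i)); apply/forall_inP => u; rewrite inE => uF.
apply/forall_inP => v; rewrite inE => vF.
by have := indep _ _ uF vF; rewrite /cell_edge eqxx.
Qed.

(* The index i : 'I_r.-1 stands for the rank i.+1, so that X i is the complex
   on the layer B_(i+1) :|: A_(i+2).  The hypothesis on A is vacuous unless A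
   contains an element of P that is both minimal and maximal: such an element
   is not a vertex of the restriction but would be a cone point of X_1(A). *)
Theorem proposition5p5 (k : fieldType) (R : realType)
    (d : Order.disp_t) (P : finPOrderType d) (rk : P -> nat) (r : nat)
    (rk_graded : is_rank_function rk) (rk_r : poset_rank rk = r)
    (D : scomplex P) (D_flag : sr_ideal k D = flag_ideal k P)
    (A : {set P})
    (A_nonisolated : (1 < r)%N ->
       forall p : P, p \in A -> rk p = 1%N -> p \notin max_elts P)
    (X : forall i : 'I_r.-1, scomplex (layer rk r A i.+1))
    (X_edge : forall i : 'I_r.-1,
       sr_ideal k (X i) = edge_ideal k (Glayer rk r A i.+1)) :
  complex_homotopy_equivalent R (restriction D A) (join_complex X).
Proof.
have KE S : (S \in faces (restriction D A)) =
    ~~ [exists C : {set P}, is_maximal_chain C && (C \subset S)] && (S \subset A).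
  by rewrite inE (faces_flag_ideal _ D_flag).
apply: (@flag_fibers_homotopy_equivalent R P (cell rk r A) _ _
  (@cell_edge _ P rk r A) (@vert _ P rk r A)).
- exact: cell_edge_sym.
- exact: join_edge_ideal_faces X_edge.
- move=> F F0 /(join_edge_ideal_faces X_edge) indep.
  rewrite KE (independent_no_chain rk_graded rk_r A_nonisolated F0 indep) /=.
  by apply/fintype.subsetP => _ /imsetP[x _ ->]; exact: vert_A.
by move=> S S0; rewrite KE => /andP[noC SA]; exact: isolated_cell noC.
Qed.
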